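(* The game CRIM (played on all partitions) is neither returnable nor domestic.
   Context: A partition is a finite weakly decreasing sequence $\lambda=[\lambda_1,\ldots,\lambda_r]$ of positive integers; the empty partition $[\,]$ is allowed. Its conjugate is $\lambda'=[\lambda'_1,\ldots,\lambda'_{\lambda_1}]$, where $\lambda'_k$ is the largest $i$ with $\lambda_i\ge k$. CRIM is the impartial game whose positions are partitions. From $\lambda=[\lambda_1,\ldots,\lambda_r]$, a row move deletes the part $\lambda_i$ for some $1\le i\le r$. A column move takes the conjugate of the partition that results from making a row move on $\lambda'$ (i.e. it removes one column of the Young diagram). The only terminal position is $[\,]$. The Sprague-Grundy value $\mathcal{G}(\lambda)$ is the minimal excluded nonnegative integer (mex) of the values $\mathcal{G}(\mu)$ over all $\mu$ reachable from $\lambda$ in one move, so terminal positions have value $0$. The misère Grundy value $\mathcal{G}^-(\lambda)$ satisfies the same mex recursion at non-terminal positions, but terminal positions have $\mathcal{G}^-=1$. The Conway pair of $\lambda$ is $(\mathcal{G}(\lambda),\mathcal{G}^-(\lambda))$; a position with Conway pair $(a,b)$ is called an $(a,b)$-position. A game is returnable if for any move from a $(0,1)$-position (resp. a $(1,0)$-position) to a non-terminal position $y$, there is a move from $y$ to a $(0,1)$-position (resp. to a $(1,0)$-position). A game is domestic if it has neither $(0,k)$-positions nor $(k,0)$-positions with $k\ge2$. *)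

(* Defs.v *)
From HB Require Import structures.
From mathcomp Require Import all_boot.
From mathcomp Require Import zify.

Set Implicit Arguments.
Unset Strict Implicit.
Unset Printing Implicit Defensive.

Record game := Game {
  position :> eqType;
  options : position -> seq position;
  options_wf : well_founded (fun y x : position => y \in options x)
}.
Arguments options {g} x : rename.

Definition terminal (G : game) (x : G) : bool := nilp (options x).

Lemma mex_exists (s : seq nat) : exists n, n \notin s.
Proof.
exists (sumn s).+1; apply/negP => /perm_to_rem/perm_sumn /=; lia.
Qed.

Definition mex (s : seq nat) : nat := ex_minn (mex_exists s).

(* The [0] branch is never reached below: [apply_if] only serves to hand the
   membership proof [y \in options x] to the recursive call; see [valueE]. *)
Definition apply_if (P : Prop) (b : bool) (r : reflect P b) (f : P -> nat) : nat :=
  if r is ReflectT h then f h else 0.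

Lemma apply_if_ext (P : Prop) b (r : reflect P b) (f g : P -> nat) :
  f =1 g -> apply_if r f = apply_if r g.
Proof. by case: r => /=. Qed.

Lemma apply_if_const (P : Prop) b (r : reflect P b) (n : nat) :
  P -> apply_if r (fun=> n) = n.
Proof. by case: r. Qed.

(* [t] is the value of terminal positions: 0 in normal play, 1 in misere play. *)
Section Values.
Variables (G : game) (t : nat).

Definition value_step (x : G)
    (rec : forall y : G, y \in options x -> nat) : nat :=
  if terminal x then t
  else mex [seq apply_if (@idP (y \in options x)) (rec y) | y <- options x].

Definition value : G -> nat :=
  Fix (@options_wf G) (fun _ => nat) value_step.

Fact value_step_ext (x : G) (f g : forall y : G, y \in options x -> nat) :
  (forall y yx, f y yx = g y yx) -> value_step f = value_step g.
Proof.
move=> fg; rewrite /value_step; case: ifP => // _; congr mex.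
by apply: eq_map => y; apply: apply_if_ext; apply: fg.
Qed.

Lemma valueE (x : G) :
  value x = if terminal x then t else mex [seq value y | y <- options x].
Proof.
rewrite /value Fix_eq; last exact: value_step_ext.
rewrite {1}/value_step; case: ifP => // _; congr mex; apply/eq_in_map => y.
exact: apply_if_const.
Qed.

End Values.

Definition grundy (G : game) (x : G) : nat := value 0 x.
Definition misere_grundy (G : game) (x : G) : nat := value 1 x.

Definition conway_pair (G : game) (x : G) : nat * nat :=
  (grundy x, misere_grundy x).

Definition returnable_for (G : game) (ab : nat * nat) : Prop :=
  forall x y : G, conway_pair x = ab -> y \in options x -> ~~ terminal y ->
  exists2 z : G, z \in options y & conway_pair z = ab.

Definition returnable (G : game) : Prop :=
  returnable_for G (0, 1) /\ returnable_for G (1, 0).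

Definition domestic (G : game) : Prop :=
  forall (x : G) (k : nat), 2 <= k ->
  conway_pair x <> (0, k) /\ conway_pair x <> (k, 0).

Definition is_partition (s : seq nat) : bool :=
  sorted geq s && all (leq 1) s.

Record partition := Partition {
  parts :> seq nat;
  partsP : is_partition parts
}.

HB.instance Definition _ := [isSub for parts].
HB.instance Definition _ := [Equality of partition by <:].

(* The largest [i], counted from 1, such that the [i]-th part is at least [k];
   [0] if there is none. *)
Definition conj_part (s : seq nat) (k : nat) : nat :=
  \max_(i < size s | k <= nth 0 s i) i.+1.

Definition conj_seq (s : seq nat) : seq nat :=
  [seq conj_part s k | k <- iota 1 (head 0 s)].

Lemma conj_part_le s k l : k <= l -> conj_part s l <= conj_part s k.
Proof.
move=> kl; apply/bigmax_leqP => i li.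
by apply: (@leq_bigmax_cond _ _ (fun i : 'I__ => i.+1)); apply: leq_trans li.
Qed.

Lemma conj_seq_partition s : is_partition (conj_seq s).
Proof.
apply/andP; split.
  rewrite /conj_seq sorted_map; apply: sub_sorted (iota_sorted 1 (head 0 s)).
  exact: conj_part_le.
apply/allP => _ /mapP[k + ->]; rewrite mem_iota.
case: s => [|a s] /= /andP[k_gt0 ka]; first by lia.
rewrite /conj_part; apply: leq_trans (_ : (@ord0 (size s)).+1 <= _) => //.
by apply: (@leq_bigmax_cond _ _ (fun i : 'I__ => i.+1)) => /=; lia.
Qed.

Definition conjugate (p : partition) : partition :=
  Partition (conj_seq_partition p).

(* Parts are indexed from 0. *)
Definition delete_seq (s : seq nat) (i : nat) : seq nat :=
  take i s ++ drop i.+1 s.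

Lemma delete_subseq s i : subseq (delete_seq s i) s.
Proof.
rewrite -{2}(cat_take_drop i s) cat_subseq //.
by rewrite -addn1 addnC -drop_drop drop_subseq.
Qed.

Lemma delete_partition (p : partition) i : is_partition (delete_seq p i).
Proof.
have /andP[ps p1] := partsP p; apply/andP; split.
  by apply: subseq_sorted (delete_subseq p i) ps => a b c; rewrite /geq /=; lia.
by apply/allP => x /(mem_subseq (delete_subseq p i)); apply: (allP p1).
Qed.

Definition delete_part (p : partition) (i : nat) : partition :=
  Partition (delete_partition p i).

Definition row_moves (p : partition) : seq partition :=
  [seq delete_part p i | i <- iota 0 (size p)].

Definition column_moves (p : partition) : seq partition :=
  [seq conjugate q | q <- row_moves (conjugate p)].

Definition crim_options (p : partition) : seq partition :=
  row_moves p ++ column_moves p.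

Lemma leq_nth_count (s : seq nat) k i :
  sorted geq s -> 0 < k -> (k <= nth 0 s i) = (i < count (leq k) s).
Proof.
move=> ss k_gt0; elim: s ss i => [|a s IHs] ss i /=; first by rewrite nth_nil; lia.
have sa : k > a -> count (leq k) s = 0.
  move=> ak; apply/eqP; rewrite -leqn0 leqNgt -has_count; apply/hasPn => b bs.
  have /allP/(_ b bs) : all (geq a) s.
    by apply: order_path_min ss => x y z; rewrite /geq /=; lia.
  by rewrite /geq /=; lia.
case: i => [|i] /=; last rewrite (IHs (path_sorted ss)).
  by case: (leqP k a) => [|/sa]; lia.
by case: (leqP k a) => [|/sa]; lia.
Qed.

Lemma conj_part_count (p : partition) k :
  0 < k -> conj_part p k = count (leq k) p.
Proof.
move=> k_gt0; have /andP[ps _] := partsP p.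
apply/eqP; rewrite eqn_leq; apply/andP; split.
  by apply/bigmax_leqP => i; rewrite leq_nth_count.
have [->//|c_gt0] := posnP (count (leq k) p).
have ip : (count (leq k) p).-1 < size p by have := count_size (leq k) p; lia.
apply: (@leq_trans (Ordinal ip).+1); first by rewrite /=; lia.
apply: (@leq_bigmax_cond _ _ (fun i : 'I__ => i.+1)).
by rewrite leq_nth_count //=; lia.
Qed.

Lemma sumn_conjugate (p : partition) : sumn (conjugate p) = sumn p.
Proof.
have count_iota a m : count (fun k => k <= a) (iota 1 m) = minn m a.
  elim: m => [|m IHm]; first by rewrite min0n.
  by rewrite -[m.+1]addn1 iotaD count_cat IHm /=; lia.
have sum_count (s : seq nat) m : all (geq m) s ->
    sumn [seq count (leq k) s | k <- iota 1 m] = sumn s.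
  elim: s => [_|a s IHs /= /andP[am sm]].
    by elim: (iota 1 m) => //= _ r ->.
  rewrite -(IHs sm) -[in RHS](minn_idPr am) -count_iota.
  by elim: (iota 1 m) => //= k r ->; lia.
transitivity (sumn [seq count (leq k) p | k <- iota 1 (head 0 p)]).
  congr sumn; apply/eq_in_map => k; rewrite mem_iota => /andP[k_gt0 _].
  exact: conj_part_count.
apply: sum_count; have /andP[] := partsP p.
case: (parts p) => //= a s ss _; rewrite leqnn /=.
by apply: order_path_min ss => x y z; rewrite /geq /=; lia.
Qed.

Lemma row_moves_sumn (p q : partition) : q \in row_moves p -> sumn q < sumn p.
Proof.
case/mapP => i; rewrite mem_iota add0n => /andP[_ ip] ->.
rewrite /= /delete_seq -[X in _ < sumn X](cat_take_drop i p).
rewrite (drop_nth 0 ip) !sumn_cat /= ltn_add2l -[ltnLHS]add0n ltn_add2r.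
by have /andP[_ /allP/(_ _ (mem_nth 0 ip))] := partsP p.
Qed.

Lemma crim_options_sumn (p q : partition) :
  q \in crim_options p -> sumn q < sumn p.
Proof.
rewrite mem_cat => /orP[/row_moves_sumn //|/mapP[r /row_moves_sumn + ->]].
by rewrite !sumn_conjugate.
Qed.

Lemma crim_wf : well_founded (fun q p : partition => q \in crim_options p).
Proof.
move=> p; have [n] := ubnP (sumn p); elim: n p => [//|n IHn] p pn.
constructor=> q /crim_options_sumn qp; apply: IHn.
exact: leq_trans qp pn.
Qed.

Definition CRIM : game := Game crim_wf.

Lemma CRIM_terminal (p : CRIM) : terminal p = nilp (p : partition).
Proof.
by rewrite /terminal /nilp /= size_cat !size_map !size_iota; case: p => [[]].
Qed.

(* Main.v *)
From mathcomp Require Import all_boot zify.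
Require Import Defs.

Set Implicit Arguments.
Unset Strict Implicit.
Unset Printing Implicit Defensive.

(* By direct computation, [4,3] is a (0,4)-position, so CRIM is not domestic;
   and [5,4,1] is a (1,0)-position whose option [4,4,1] (remove the last column)
   has no (1,0)-option, so CRIM is not returnable. *)

(** A form of [mex] that evaluates: [ex_minn] is blocked by the opaque proof [mex_exists]. *)
Definition mex_find (s : seq nat) : nat :=
  find (fun n => n \notin s) (iota 0 (size s).+1).

Lemma mexE (s : seq nat) : mex s = mex_find s.
Proof.
have fresh : has (fun n => n \notin s) (iota 0 (size s).+1).
  (* Pigeonhole: [size s] entries cannot cover [(size s).+1] distinct numbers. *)
  apply: contraT => /hasPn sub.
  have /(uniq_leq_size (iota_uniq _ _)) : {subset iota 0 (size s).+1 <= s}.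
    by move=> n /sub /negPn.
  by rewrite size_iota ltnn.
have find_lt := fresh; rewrite has_find size_iota in find_lt.
rewrite /mex /mex_find; case: ex_minnP => m mNs m_min.
apply/eqP; rewrite eqn_leq; apply/andP; split.
  by apply: m_min; have := nth_find 0 fresh; rewrite nth_iota.
rewrite leqNgt; apply/negP => m_lt.
by have := before_find 0 m_lt; rewrite nth_iota ?mNs //; lia.
Qed.

(** Counting replaces the locked big operator of [conj_part], which does not reduce; bare sequences
    spare the computation the partition proofs. *)
Definition conj_count (s : seq nat) : seq nat :=
  [seq count (leq k) s | k <- iota 1 (head 0 s)].

Definition deletions (s : seq nat) : seq (seq nat) :=
  [seq delete_seq s i | i <- iota 0 (size s)].

Definition crim_moves (s : seq nat) : seq (seq nat) :=
  deletions s ++ [seq conj_count q | q <- deletions (conj_count s)].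

Lemma conj_countE (p : partition) : conjugate p = conj_count p :> seq nat.
Proof.
by apply/eq_in_map => k; rewrite mem_iota => /andP[k_gt0 _]; apply: conj_part_count.
Qed.

Lemma parts_row_moves (p : partition) :
  map parts (row_moves p) = deletions p.
Proof. by rewrite -map_comp. Qed.

Lemma parts_crim_options (p : partition) :
  map parts (crim_options p) = crim_moves p.
Proof.
rewrite /crim_options /crim_moves map_cat parts_row_moves -conj_countE.
rewrite -parts_row_moves -!map_comp; congr cat.
by apply: eq_map => i; apply: (conj_countE (delete_part _ _)).
Qed.

Lemma mem_crim_options (p q : partition) :
  (q \in crim_options p) = (parts q \in crim_moves p).
Proof. by rewrite -parts_crim_options (mem_map val_inj). Qed.

(** The fuel [n] replaces the well-founded recursion of [value]. *)
Fixpoint crim_value_upto (t n : nat) (s : seq nat) : nat :=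
  if n is n'.+1 then
    if nilp s then t
    else mex_find (map (crim_value_upto t n') (crim_moves s))
  else t.

Definition crim_value (t : nat) (s : seq nat) : nat :=
  crim_value_upto t (sumn s) s.

(** Every move lowers the sum of the parts, so that sum is enough fuel. *)
Lemma value_upto (t n : nat) (p : CRIM) :
  sumn (parts p) <= n -> value t p = crim_value_upto t n (parts p).
Proof.
elim: n p => [|n IHn] p pn; rewrite valueE CRIM_terminal /=.
  (* Parts are positive, so sum 0 forces the empty partition, and the out-of-fuel value [t] is
     correct. *)
  have [_] := andP (partsP p); case: (parts p) pn => //= a s.
  by move=> + /andP[]; lia.
case: ifP => // _; rewrite mexE -parts_crim_options -map_comp; congr mex_find.
apply/eq_in_map => q /crim_options_sumn qp /=; apply: IHn; lia.
Qed.

Definition crim_pair (s : seq nat) : nat * nat :=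
  (crim_value 0 s, crim_value 1 s).

Lemma conway_pairE (p : CRIM) : conway_pair p = crim_pair (parts p).
Proof. by congr pair; apply: value_upto. Qed.

Lemma CRIM_not_domestic : ~ domestic CRIM.
Proof.
pose x : CRIM := @Partition [:: 4; 3] isT.
case/(_ x 4 isT) => + _; apply; rewrite conway_pairE.
by vm_compute.
Qed.

Lemma CRIM_not_returnable : ~ returnable CRIM.
Proof.
pose x : CRIM := @Partition [:: 5; 4; 1] isT.
pose y : CRIM := @Partition [:: 4; 4; 1] isT.
have no_reply : all (fun s => crim_pair s != (1, 0)) (crim_moves [:: 4; 4; 1]).
  by vm_compute.
have xE : conway_pair x = (1, 0) by rewrite conway_pairE; vm_compute.
have xy : y \in options x by rewrite [_ \in _]mem_crim_options; vm_compute.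
case=> _ /(_ x y xE xy); rewrite CRIM_terminal => -[//|z].
rewrite [_ \in _]mem_crim_options => /(allP no_reply) /eqP zN.
by rewrite conway_pairE.
Qed.

Theorem theorem4 : ~ returnable CRIM /\ ~ domestic CRIM.
Proof. by split; [apply: CRIM_not_returnable | apply: CRIM_not_domestic]. Qed.
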